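(* Let $A$ be a commutative ring, $\mathfrak{a}$ an ideal of $A$, and $M$ an $A$-module with $\mathfrak{a}$-adic completion $\widehat{M}$. The following conditions are equivalent: (i) The $A$-module $\widehat{M}$ is $\mathfrak{a}$-adically complete. (ii) The metrics $\operatorname{dist}_{\mathfrak{a},\widehat{M}}$ and $\operatorname{dist}'$ on $\widehat{M}$ coincide.
   Context: For $i \geq 0$ write $A_i := A/\mathfrak{a}^{i+1}$. For an $A$-module $M$, its $\mathfrak{a}$-adic completion is $\widehat{M} := \varprojlim_i (A_i \otimes_A M)$, with canonical homomorphism $\tau_M : M \to \widehat{M}$ and canonical surjections $\pi_{M,i} : \widehat{M} \to A_i \otimes_A M$. A module $N$ is $\mathfrak{a}$-adically separated (resp. complete) if $\tau_N : N \to \widehat{N}$ is injective (resp. bijective). The module $\widehat{M}$ is always $\mathfrak{a}$-adically separated. Two metrics on $\widehat{M}$ (with the convention $(1/2)^\infty = 0$): (a) Put $F^0\widehat{M} := \widehat{M}$ and $F^i \widehat{M} := \operatorname{Ker}(\pi_{M,i-1})$ for $i \geq 1$. Let $\operatorname{ord}'(m) := \sup\{ i \in \mathbb{N} \mid m \in F^i\widehat{M} \} \in \mathbb{N}\cup\{\infty\}$ and $\operatorname{dist}'(m,n) := (1/2)^{\operatorname{ord}'(m-n)}$ for $m,n \in \widehat{M}$. (b) Let $\operatorname{ord}_{\mathfrak{a},\widehat{M}}(m) := \sup\{ i \in \mathbb{N} \mid m \in \mathfrak{a}^i\widehat{M} \} \in \mathbb{N}\cup\{\infty\}$ and $\operatorname{dist}_{\mathfrak{a},\widehat{M}}(m,n)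 := (1/2)^{\operatorname{ord}_{\mathfrak{a},\widehat{M}}(m-n)}$ for $m,n\in\widehat{M}$. *)

(* Defs.v *)
From HB Require Import structures.
From mathcomp Require Import all_boot all_order all_algebra.
From mathcomp Require Import all_classical all_reals ereal exp.

Set Implicit Arguments.
Unset Strict Implicit.
Unset Printing Implicit Defensive.

Import GRing.Theory.

Local Open Scope classical_set_scope.
Local Open Scope ring_scope.
Local Open Scope quotient_scope.

(* Rings are [comPzRingType]s, so that the zero ring is allowed.  Submodules
   are boolean predicates, which is no restriction classically. *)

Section Submodules.
Variables (A : pzRingType) (V : lmodType A).

(* The smallest submodule containing S. *)
Definition span (S : set V) : {pred V} := fun x =>
  `[< forall W : {pred V}, submod_closed W ->
      (forall y, S y -> y \in W) -> x \in W >].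

Lemma spanP (S : set V) x :
  reflect (forall W : {pred V}, submod_closed W ->
             (forall y, S y -> y \in W) -> x \in W) (x \in span S).
Proof. exact: asboolP. Qed.

Lemma mem_span (S : set V) x : S x -> x \in span S.
Proof. by move=> Sx; apply/spanP => W _; apply. Qed.

Lemma span_submod_closed (S : set V) : submod_closed (span S).
Proof.
split=> [|a u v /spanP uS /spanP vS]; apply/spanP => W WC SW; first exact: WC.1.
by apply: WC.2; [exact: uS | exact: vS].
Qed.

HB.instance Definition _ S := GRing.isSubmodClosed.Build A V (span S)
  (span_submod_closed S).

Record submod (W : submodClosed V) :=
  Submod { submod_val : V; _ : submod_val \in (W : {pred V}) }.

Section SubmodInstances.
Variable W : submodClosed V.
HB.instance Definition _ := [isSub for @submod_val W].
HB.instance Definition _ := [Choice of submod W by <:].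
HB.instance Definition _ := [SubChoice_isSubLmodule of submod W by <:].
End SubmodInstances.

End Submodules.

Section QuotientModule.
Variables (A : pzRingType) (V : lmodType A) (W : submodClosed V).

(* [submodClosed] does not inherit from the [zmodClosed] that
   [Quotient.quot] expects. *)
Definition submod_zmod : {pred V} := W.
HB.instance Definition _ := GRing.isSubmodClosed.Build A V submod_zmod
  (submodClosedP W).

Definition quotmod := Quotient.quot submod_zmod.
HB.instance Definition _ := GRing.Zmodule.on quotmod.

Definition qproj (x : V) : quotmod := \pi x.

Lemma qproj_eq x y : (qproj x == qproj y) = (x - y \in W).
Proof. exact/esym/(Quotient.idealrBE submod_zmod). Qed.

Lemma qproj_repr (q : quotmod) : qproj (repr q) = q.
Proof. exact: reprK. Qed.

Lemma qprojD : {morph qproj : x y / x + y}.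
Proof. by move=> x y; rewrite /qproj piE. Qed.

Definition qscale a (q : quotmod) : quotmod := qproj (a *: repr q).

Lemma qscaleE a x : qscale a (qproj x) = qproj (a *: x).
Proof.
by apply/eqP; rewrite qproj_eq -scalerBr rpredZ// -qproj_eq qproj_repr.
Qed.

Lemma qscaleA a b q : qscale a (qscale b q) = qscale (a * b) q.
Proof. by rewrite -[q]qproj_repr !qscaleE scalerA. Qed.

Lemma qscale1 : left_id 1 qscale.
Proof. by move=> q; rewrite -[q]qproj_repr qscaleE scale1r. Qed.

Lemma qscaleDr : right_distributive qscale +%R.
Proof.
move=> a p q; rewrite -[p]qproj_repr -[q]qproj_repr.
by rewrite -qprojD !qscaleE -qprojD scalerDr.
Qed.

Lemma qscaleDl q : {morph qscale^~ q : a b / a + b}.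
Proof.
by move=> a b; rewrite -[q]qproj_repr !qscaleE -qprojD scalerDl.
Qed.

HB.instance Definition _ := GRing.Zmodule_isLmodule.Build A quotmod
  qscaleA qscale1 qscaleDr qscaleDl.

Lemma qproj_is_linear : linear qproj.
Proof. by move=> a x y; rewrite qprojD -qscaleE. Qed.

HB.instance Definition _ := GRing.isLinear.Build A V quotmod _ qproj
  qproj_is_linear.

End QuotientModule.

Section FreeModule.
Variables (A : pzRingType) (K : choiceType).

Definition finsupp : {pred (K -> A^o)} := fun f =>
  `[< finite_set [set k | f k != 0] >].

Lemma finsupp_submod_closed : submod_closed finsupp.
Proof.
split=> [|a f g /asboolP fS /asboolP gS]; apply/asboolP.
  by apply: sub_finite_set (finite_set0 K) => k /=; rewrite eqxx.
have /sub_finite_set : [set k | (a *: f + g) k != 0] `<=`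
    [set k | f k != 0] `|` [set k | g k != 0]; last first.
  by apply; rewrite finite_setU.
move=> k /= fgk; have [fk0|] := eqVneq (f k) 0; [right|by left].
by apply: contraNneq fgk => gk0; rewrite -[(_ + _) k]/(a *: f k + g k) fk0 gk0
  scaler0 addr0.
Qed.

HB.instance Definition _ := GRing.isSubmodClosed.Build A (K -> A^o) finsupp
  finsupp_submod_closed.

Definition freemod := submod finsupp.
HB.instance Definition _ := GRing.Lmodule.on freemod.

Lemma finsupp_delta k : (fun k' => (k' == k)%:R : A^o) \in finsupp.
Proof.
apply/asboolP; apply: sub_finite_set (finite_set1 k) => k' /=.
by case: (eqVneq k' k) => //=; rewrite eqxx.
Qed.

Definition fbasis k : freemod := Submod (finsupp_delta k).

Definition fcoef (f : freemod) (k : K) : A := val f k.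

Lemma fcoefP a f g k : fcoef (a *: f + g) k = a * fcoef f k + fcoef g k.
Proof. by []. Qed.

Section Lift.
Variables (V : lmodType A) (b : K -> V).

Definition freelift (f : freemod) : V := \sum_(k \in setT) fcoef f k *: b k.

Lemma freeliftE (f : freemod) (D : set K) : finite_set D ->
  [set k | fcoef f k != 0] `<=` D -> freelift f = \sum_(k \in D) fcoef f k *: b k.
Proof.
move=> Dfin fD; rewrite /freelift; apply/esym/fsbig_widen => // k [_ /= kD].
have [-> |/fD//] := eqVneq (fcoef f k) 0; exact: scale0r.
Qed.

Lemma freelift_is_linear : linear freelift.
Proof.
move=> a f g.
pose D := [set k | fcoef f k != 0] `|` [set k | fcoef g k != 0].
have Dfin : finite_set D.
  by rewrite finite_setU; split; apply/asboolP; [exact: (valP f)|exact: (valP g)].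
rewrite !(@freeliftE _ D)//.
- under eq_fsbigr do rewrite fcoefP scalerDl -scalerA.
  rewrite fsbig_split//= !fsbig_finite//= scaler_sumr //.
- by move=> k kg; right.
- by move=> k kf; left.
- move=> k; rewrite /= fcoefP; have [fk0|fk0] := eqVneq (fcoef f k) 0; last by left.
  by rewrite fk0 mulr0 add0r; right.
Qed.

HB.instance Definition _ := GRing.isLinear.Build A freemod V _ freelift
  freelift_is_linear.

Lemma freelift_basis k : freelift (fbasis k) = b k.
Proof.
rewrite (@freeliftE _ [set k])//.
  by rewrite fsbig_set1 /fcoef/= eqxx scale1r.
by move=> k'; rewrite /fcoef/=; case: (eqVneq k' k) => //=; rewrite eqxx.
Qed.

End Lift.
End FreeModule.

(* U (x)_A V as the free module on U x V modulo the bilinearity relations. *)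
Section Tensor.
Variables (A : comPzRingType) (U V : lmodType A).

Local Notation e u v := (fbasis A (u, v)).

Definition tensor_rel : set (freemod A (U * V)%type) :=
  [set x | exists a u u' v, x = e (a *: u + u') v - (a *: e u v + e u' v)] `|`
  [set x | exists a u v v', x = e u (a *: v + v') - (a *: e u v + e u v')].

Definition tensor := quotmod (span tensor_rel).
HB.instance Definition _ := GRing.Lmodule.on tensor.

Definition tens (u : U) (v : V) : tensor := qproj _ (e u v).

Lemma tens_linearl v : linear (tens^~ v).
Proof.
move=> a u u'; apply/eqP; rewrite /tens -linearP qproj_eq.
by apply: mem_span; left; exists a, u, u', v.
Qed.

Lemma tens_linearr u : linear (tens u).
Proof.
move=> a v v'; apply/eqP; rewrite /tens -linearP qproj_eq.
by apply: mem_span; right; exists a, u, v, v'.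
Qed.

Section Lift.
Variables (W : lmodType A) (b : U -> V -> W).

(* The linear map u (x) v |-> b u v; it is only meaningful for b bilinear. *)
Definition tensor_lift (t : tensor) : W :=
  freelift (fun p => b p.1 p.2) (repr t).

Hypothesis bl : forall v, linear (b^~ v).
Hypothesis br : forall u, linear (b u).

Lemma tensor_lift_qproj f :
  tensor_lift (qproj _ f) = freelift (fun p => b p.1 p.2) f.
Proof.
set h := freelift _; apply/eqP; rewrite -subr_eq0 -linearB; apply/eqP.
set x := _ - f; have : x \in span tensor_rel by rewrite -qproj_eq qproj_repr.
move=> /spanP /(_ (fun x => h x == 0)) xK; apply/eqP; apply: xK.
  split=> [|a u v]; rewrite !unfold_in; first by rewrite /h linear0.
  by rewrite /h linearP/= => /eqP-> /eqP->; rewrite scaler0 addr0.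
move=> y [[a [u [u' [v ->]]]]|[a [u [v [v' ->]]]]]; rewrite unfold_in;
  by rewrite /h linearB linearP/= !freelift_basis/= ?bl ?br subrr.
Qed.

Lemma tensor_liftE u v : tensor_lift (tens u v) = b u v.
Proof. by rewrite tensor_lift_qproj freelift_basis. Qed.

Lemma tensor_lift_linear : linear tensor_lift.
Proof.
move=> a s t; rewrite -[s]qproj_repr -[t]qproj_repr -linearP.
by rewrite !tensor_lift_qproj linearP.
Qed.

End Lift.
End Tensor.

Section ProductModule.
Variables (A : pzRingType) (T : nat -> lmodType A).

Definition prodmod := forall i, T i.
HB.instance Definition _ := Choice.on prodmod.
Implicit Types x y z : prodmod.

Definition prodmod_zero : prodmod := fun i => 0.
Definition prodmod_opp x : prodmod := fun i => - x i.
Definition prodmod_add x y : prodmod := fun i => x i + y i.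
Definition prodmod_scale a x : prodmod := fun i => a *: x i.

Lemma prodmod_addA : associative prodmod_add.
Proof. by move=> x y z; apply: functional_extensionality_dep => i; apply: addrA. Qed.

Lemma prodmod_addC : commutative prodmod_add.
Proof. by move=> x y; apply: functional_extensionality_dep => i; apply: addrC. Qed.

Lemma prodmod_add0 : left_id prodmod_zero prodmod_add.
Proof. by move=> x; apply: functional_extensionality_dep => i; apply: add0r. Qed.

Lemma prodmod_addN : left_inverse prodmod_zero prodmod_opp prodmod_add.
Proof. by move=> x; apply: functional_extensionality_dep => i; apply: addNr. Qed.

HB.instance Definition _ := GRing.isZmodule.Build prodmod
  prodmod_addA prodmod_addC prodmod_add0 prodmod_addN.

Lemma prodmod_scaleA a b x :
  prodmod_scale a (prodmod_scale b x) = prodmod_scale (a * b) x.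
Proof. by apply: functional_extensionality_dep => i; apply: scalerA. Qed.

Lemma prodmod_scale1 : left_id 1 prodmod_scale.
Proof. by move=> x; apply: functional_extensionality_dep => i; apply: scale1r. Qed.

Lemma prodmod_scaleDr : right_distributive prodmod_scale +%R.
Proof. by move=> a x y; apply: functional_extensionality_dep => i; apply: scalerDr. Qed.

Lemma prodmod_scaleDl x : {morph prodmod_scale^~ x : a b / a + b}.
Proof. by move=> a b; apply: functional_extensionality_dep => i; apply: scalerDl. Qed.

HB.instance Definition _ := GRing.Zmodule_isLmodule.Build A prodmod
  prodmod_scaleA prodmod_scale1 prodmod_scaleDr prodmod_scaleDl.

End ProductModule.

Section InverseLimit.
Variables (A : pzRingType) (T : nat -> lmodType A).
Variable f : forall i, {linear T i.+1 -> T i}.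

Definition compatible : {pred prodmod T} :=
  fun x => `[< forall i, f i (x i.+1) = x i >].

Lemma compatible_submod_closed : submod_closed compatible.
Proof.
split=> [|a x y /asboolP xC /asboolP yC]; apply/asboolP => i.
  exact: linear0.
rewrite -[(a *: x + y) i.+1]/(a *: x i.+1 + y i.+1).
by rewrite linearP/= xC yC.
Qed.

HB.instance Definition _ := GRing.isSubmodClosed.Build A (prodmod T) compatible
  compatible_submod_closed.

Definition invlim := submod compatible.
HB.instance Definition _ := GRing.Lmodule.on invlim.

End InverseLimit.

(* Ideals are the submodules of the regular module; they may be improper. *)
Notation ideal A := (submodClosed A^o).

Section Adic.
Variables (A : comPzRingType) (I : ideal A).

(* I ^ n, generated by the n-fold products; for n = 0 the empty product 1
   generates A. *)
Definition ideal_pow_gen (n : nat) : set A^o :=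
  [set x | exists2 a : 'I_n -> A, (forall k, a k \in (I : {pred A^o})) &
                                  x = \prod_(k < n) a k].

Definition ideal_pow (n : nat) : ideal A := span (ideal_pow_gen n).

Lemma ideal_powS n x : x \in ideal_pow n.+1 -> x \in ideal_pow n.
Proof.
move/spanP; apply; first exact: span_submod_closed.
move=> _ [a aI ->]; rewrite big_ord_recl.
apply: (@rpredZ _ _ (ideal_pow n) (a ord0)); apply: mem_span.
by exists (fun k => a (lift ord0 k)).
Qed.

Definition ideal_pow_mod (V : lmodType A) (n : nat) : submodClosed V :=
  span [set x | exists2 a : A, a \in ideal_pow n & exists v, x = a *: v].

Arguments ideal_pow_mod V n : clear implicits.

(* A_i = A / I ^ (i + 1), as an A-module *)
Definition truncation (i : nat) := quotmod (ideal_pow i.+1).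
HB.instance Definition _ i := GRing.Lmodule.on (truncation i).

Definition truncation_one (i : nat) : truncation i := qproj (ideal_pow i.+1) 1.

Definition truncation_map (i : nat) (q : truncation i.+1) : truncation i :=
  qproj (ideal_pow i.+1) (repr q).

Lemma truncation_mapE i x :
  truncation_map (qproj (ideal_pow i.+2) x : truncation i.+1) =
  qproj (ideal_pow i.+1) x.
Proof.
apply/eqP; rewrite qproj_eq; apply: ideal_powS.
by rewrite -qproj_eq qproj_repr.
Qed.

Lemma truncation_map_is_linear i : linear (@truncation_map i).
Proof.
move=> a p q; rewrite -[p]qproj_repr -[q]qproj_repr -linearP.
by rewrite !truncation_mapE linearP.
Qed.

HB.instance Definition _ i := GRing.isLinear.Build A (truncation i.+1)
  (truncation i) _ (@truncation_map i) (@truncation_map_is_linear i).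

Section Completion.
Variable M : lmodType A.

Definition level (i : nat) : lmodType A := tensor (truncation i) M.

Definition level_map (i : nat) : level i.+1 -> level i :=
  tensor_lift (fun q m => tens (truncation_map q) m).

Lemma level_bl i m :
  linear (fun q : truncation i.+1 => tens (truncation_map q) m : level i).
Proof. by move=> a p q; rewrite linearP tens_linearl. Qed.

Lemma level_br i (q : truncation i.+1) :
  linear (fun m : M => tens (truncation_map q) m : level i).
Proof. by move=> a p r; rewrite tens_linearr. Qed.

Lemma level_map_is_linear i : linear (@level_map i).
Proof. exact: tensor_lift_linear (@level_bl i) (@level_br i). Qed.

HB.instance Definition _ i := GRing.isLinear.Build A (level i.+1) (level i) _
  (@level_map i) (@level_map_is_linear i).

Lemma level_mapE i (q : truncation i.+1) (m : M) :
  level_map (tens q m) = tens (truncation_map q) m.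
Proof. exact: tensor_liftE (@level_bl i) (@level_br i) q m. Qed.

Definition completion := invlim (fun i => @level_map i : {linear _ -> _}).
HB.instance Definition _ := GRing.Lmodule.on completion.

Definition completion_proj (i : nat) (x : completion) : level i := submod_val x i.

Lemma completion_proj_is_linear i : linear (completion_proj i).
Proof. by []. Qed.

HB.instance Definition _ i := GRing.isLinear.Build A completion (level i) _
  (completion_proj i) (completion_proj_is_linear i).

Lemma completion_map_subproof (m : M) :
  (fun i => tens (truncation_one i) m : level i) \in
  compatible (fun i => @level_map i : {linear _ -> _}).
Proof. by apply/asboolP => i /=; rewrite level_mapE truncation_mapE. Qed.

(* m |-> (1 (x) m)_i *)
Definition completion_map (m : M) : completion :=
  Submod (completion_map_subproof m).

Lemma completion_map_is_linear : linear completion_map.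
Proof.
move=> a m n; apply: val_inj; apply: functional_extensionality_dep => i.
exact: tens_linearr.
Qed.

HB.instance Definition _ := GRing.isLinear.Build A M completion _ completion_map
  completion_map_is_linear.

Definition adically_complete : Prop := bijective completion_map.

(* F^0 is everything and F^(i + 1) the kernel of the i-th projection. *)
Definition kerfilt (i : nat) : {pred completion} :=
  fun x => if i is i'.+1 then completion_proj i' x == 0 else true.

End Completion.
End Adic.

(* The distance attached to a filtration F of V.  N + {oo} is read inside the
   extended reals, where the supremum of a set of naturals is a natural or +oo. *)
Section Distance.
Variables (R : realType) (V : zmodType) (F : nat -> {pred V}).

Definition filt_ord (x : V) : \bar R :=
  ereal_sup [set (i%:R)%:E | i in [set i : nat | x \in F i]].

Definition half_pow (d : \bar R) : R := if d is r%:E then (2^-1) `^ r else 0.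

Definition filt_dist (x y : V) : R := half_pow (filt_ord (x - y)).

End Distance.

Section Metrics.
Variables (R : realType) (A : comPzRingType) (I : ideal A) (M : lmodType A).

Definition ker_dist : completion I M -> completion I M -> R :=
  filt_dist R (@kerfilt A I M).

Definition adic_dist (V : lmodType A) : V -> V -> R :=
  filt_dist R (fun i => ideal_pow_mod I V i).

End Metrics.

(* Main.v *)
Require Import Defs.
From HB Require Import structures.
From mathcomp Require Import all_boot all_order all_algebra.
From mathcomp Require Import all_classical all_reals.
From mathcomp Require Import ereal exp.

Set Implicit Arguments.
Unset Strict Implicit.
Unset Printing Implicit Defensive.

(** Let N be the completion of M, with the two filtrations I^i N and
    F^i N = Ker (N -> level i-1).  Both decrease and begin with N itself, so a
    distance determines the filtration it comes from through its balls of
    radius (1/2)^i ([filt_dist_eqP]); the metrics coincide exactly when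
    I^i N = F^i N for all i.  One always has I^i N <= F^i N, because
    A/I^i (x) M is killed by I^i ([ideal_pow_mod_kerfilt]).

    Since A/I^(i+1) (x) V is V/I^(i+1) V ([trunc_class_surj],
    [trunc_class_eq0]), elements of the completion of V are represented by
    sequences s of V with s (i+1) - s i in I^(i+1) V, and V is complete exactly
    when it is separated and each such sequence has a limit.

    If N is complete and x is in F^(i+1) N, write x as the class of a Cauchy
    sequence s in M, so that s i lies in I^(i+1) M.  The images of the s k in N
    form an I-adic Cauchy sequence, and completeness gives it an I-adic limit
    y.  The limit satisfies y - tau (s i) in I^(i+1) N, hence y is in
    I^(i+1) N; and y = x because I^k N <= F^k N forces the two to have the same
    projections ([complete_kerfilt]).

    Conversely, if the filtrations agree, N is I-adically separated and
    complete because it is so for the filtration F by construction: the limit of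
    a Cauchy sequence in N has for i-th projection the i-th projection of the
    i-th term ([kerfilt_complete]). *)

Import Order.TTheory GRing.Theory Num.Theory.

Local Open Scope classical_set_scope.
Local Open Scope ring_scope.

(** * Spans, and distances attached to filtrations *)

Lemma span_sub (A : pzRingType) (V : lmodType A) (S : set V)
    (W : submodClosed V) (x : V) :
  (forall y, S y -> y \in (W : {pred V})) ->
  x \in Defs.span S -> x \in (W : {pred V}).
Proof. by move=> SW /spanP; apply => //; apply: submodClosedP. Qed.

Lemma span_ker (A : pzRingType) (U V : lmodType A) (f : {linear U -> V})
    (S : set U) x :
  (forall y, S y -> f y = 0) -> x \in Defs.span S -> f x = 0.
Proof.
move=> fS /spanP/(_ (fun y => f y == 0)) xK; apply/eqP/xK.
  split=> [|a u v]; rewrite !unfold_in ?linear0// linearP => /eqP-> /eqP->.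
  by rewrite scaler0 addr0.
by move=> y Sy; rewrite unfold_in fS.
Qed.

Section FiltrationDistance.
Variables (R : realType) (V : zmodType).

Lemma filt_ord_ge (F : nat -> {pred V}) x i :
  x \in F i -> ((i%:R)%:E <= filt_ord R F x)%E.
Proof. by move=> xF; apply: ereal_sup_ubound; exists i. Qed.

(** The order of z is an element of N + {oo} at least i when z is in F i, and at
    most i - 1 otherwise, so the closed ball of radius (1/2)^i is a coset of
    F i. *)
Lemma filt_dist_leE (F : nat -> {pred V}) x y i :
  (forall z, z \in F 0%N) -> (forall j z, z \in F j.+1 -> z \in F j) ->
  (filt_dist R F x y <= 2^-1 `^ i%:R) = (x - y \in F i).
Proof.
rewrite /filt_dist; move: (x - y) => {x y}z F0 FS.
have Fle j k : (j <= k)%N -> z \in F k -> z \in F j.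
  by elim: k => [|k IHk]; rewrite leq_eqVlt => /predU1P[->//|] // /IHk h /FS.
have half01 : 0 < (2^-1 : R) <= 1 by rewrite invr_gt0 ltr0n invf_le1 ?ltr0n ?ler1n.
apply/idP/idP => [|zF].
  apply: contraTT => zF; rewrite -ltNge.
  (* As F is decreasing, z can only lie in F j for j <= i, where i + 1 is the
     index of the ball; F 0 bounds the order from below, which keeps it finite. *)
  case: i zF => [|i] zF; first by rewrite F0 in zF.
  have : (filt_ord R F z <= (i%:R)%:E)%E.
    apply: ge_ereal_sup => _ [j /= zFj <-]; rewrite lee_fin ler_nat leqNgt.
    by apply: contra zF => /Fle; apply.
  have := filt_ord_ge (F0 z); case: (filt_ord R F z) => [r| |] //=.
  rewrite !lee_fin => _ r_le.
  apply: (@lt_le_trans _ _ (2^-1 `^ i%:R)); last exact: ger_powR.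
  by rewrite !powR_mulrn ?invr_ge0 ?ler0n// exprS gtr_pMl ?exprn_gt0 ?invr_gt0
    ?ltr0n// invf_lt1 ?ltr0n ?ltr1n.
have := filt_ord_ge zF; case: (filt_ord R F z) => [r| |] //=.
by rewrite lee_fin => /(ger_powR half01).
Qed.

Lemma filt_dist_eqP (F G : nat -> {pred V}) :
  (forall z, z \in F 0%N) -> (forall j z, z \in F j.+1 -> z \in F j) ->
  (forall z, z \in G 0%N) -> (forall j z, z \in G j.+1 -> z \in G j) ->
  (forall x y, filt_dist R F x y = filt_dist R G x y) <->
  (forall i, F i =i G i).
Proof.
move=> F0 FS G0 GS; split=> [FG i x|FG x y].
  by rewrite -[x]subr0 -(filt_dist_leE _ _ _ F0 FS) FG filt_dist_leE.
suff FGE : [set i | x - y \in F i] = [set i | x - y \in G i].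
  by rewrite /filt_dist /filt_ord FGE.
by apply/funext => i /=; rewrite FG.
Qed.

End FiltrationDistance.

(** * Generation of free modules and tensor products *)

Lemma freemod_ind (A : pzRingType) (K : choiceType) (P : freemod A K -> Prop) :
  P 0 -> (forall a k f, P f -> P (a *: fbasis A k + f)) -> forall f, P f.
Proof.
move=> P0 PS f.
(* Each basis vector must be counted once in the expansion of f, whence undup. *)
have /asboolP/finite_seqP[s' fs'] := valP f; pose s := undup s'.
have -> : f = \sum_(k <- s) fcoef f k *: fbasis A k; last first.
  by elim: s => [|k s IHs]; rewrite ?big_nil// big_cons; apply: PS.
apply: val_inj; apply/funext => k.
have -> (r : seq K) : val (\sum_(j <- r) fcoef f j *: fbasis A j) k =
    \sum_(j <- r) fcoef f j * (k == j)%:R :> A.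
  elim: r => [|j r IHr]; first by rewrite !big_nil.
  by rewrite !big_cons -IHr.
have [ks|ks] := boolP (k \in s).
  rewrite (bigD1_seq k) ?undup_uniq//= eqxx mulr1 big1 ?addr0// => j.
  by rewrite eq_sym => /negPf->; rewrite mulr0.
rewrite big_seq big1 => [|j js]; last first.
  by case: eqP => [kj|]; [rewrite kj js in ks | rewrite mulr0].
apply/eqP; apply: contraNT ks => fk; rewrite mem_undup.
by have : [set k | val f k != 0] k := fk; rewrite fs'.
Qed.

(** Versions of [linear0] and [linearZ] that take the linearity proof itself,
    for maps such as a partially applied tensor that carry no bundled
    structure. *)
Section BareLinear.
Variables (A : pzRingType) (U V : lmodType A) (f : U -> V).
Hypothesis f_lin : linear f.

Lemma linear_prop0 : f 0 = 0.
Proof. by have := f_lin (-1) 0 0; rewrite scaler0 addr0 scaleN1r addNr. Qed.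

Lemma linear_propZ a : {morph f : u / a *: u}.
Proof. by move=> u; rewrite -[_ *: u]addr0 f_lin linear_prop0 addr0. Qed.

End BareLinear.

Section TensorTheory.
Variables (A : comPzRingType) (U V : lmodType A).
Implicit Types (u : U) (v : V) (t : tensor U V).

Lemma tensZl a u v : tens (a *: u) v = a *: tens u v.
Proof. exact: (linear_propZ (tens_linearl v)). Qed.

Lemma tensZr a u v : tens u (a *: v) = a *: tens u v.
Proof. exact: (linear_propZ (tens_linearr u)). Qed.

Lemma tensor_ind (P : tensor U V -> Prop) :
  P 0 -> (forall a u v t, P t -> P (a *: tens u v + t)) -> forall t, P t.
Proof.
move=> P0 PS t; rewrite -[t]qproj_repr.
elim/freemod_ind: (repr t) => [|a [u v] f Pf].
  have -> : qproj (Defs.span (@tensor_rel A U V)) 0 = 0 by apply: linear0.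
  exact: P0.
have -> : qproj (Defs.span (@tensor_rel A U V)) (a *: fbasis A (u, v) + f) =
    a *: tens u v + qproj _ f by apply: qproj_is_linear.
exact: PS.
Qed.

(** Scalars move from U to V, so a generator u0 of U absorbs the left factor of
    every pure tensor. *)
Lemma tensor_cyclic u0 t :
  (forall u, exists a, u = a *: u0) -> exists v, t = tens u0 v.
Proof.
move=> u0_gen; elim/tensor_ind: t => [|a u v t [w ->]].
  by exists 0; rewrite -[0 in RHS](scale0r 0) tensZr scale0r.
have [b ->] := u0_gen u; exists (a *: (b *: v) + w).
by rewrite tens_linearr tensZl tensZr.
Qed.

End TensorTheory.

(** * Levels as quotients, completions as Cauchy sequences *)

Section AdicModule.
Variables (A : comPzRingType) (I : ideal A) (V : lmodType A).

Lemma mem_ideal_pow0 a : a \in ideal_pow I 0.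
Proof.
rewrite -[a]mulr1; apply: (@rpredZ _ _ (ideal_pow I 0)); apply: mem_span.
by exists (fun=> 0) => [[]//|]; rewrite big_ord0.
Qed.

Lemma mem_ideal_pow_mod0 v : v \in ideal_pow_mod I V 0.
Proof.
by apply: mem_span; exists 1; [exact: mem_ideal_pow0 | exists v; rewrite scale1r].
Qed.

Lemma ideal_pow_modS n v :
  v \in ideal_pow_mod I V n.+1 -> v \in ideal_pow_mod I V n.
Proof.
apply: span_sub => _ [a aI [w ->]]; apply: mem_span.
by exists a; [exact: ideal_powS | exists w].
Qed.

(** The canonical map from V to A/I^(i+1) (x) V, shown below to be the quotient
    of V by I^(i+1) V. *)
Definition trunc_class i (v : V) : level I V i := tens (truncation_one I i) v.

Lemma trunc_class_is_linear i : linear (trunc_class i).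
Proof. exact: tens_linearr. Qed.

HB.instance Definition _ i := GRing.isLinear.Build A V (level I V i) _
  (trunc_class i) (trunc_class_is_linear i).

Lemma trunc_class0 i : trunc_class i 0 = 0.
Proof. exact: linear_prop0 (@trunc_class_is_linear i). Qed.

Lemma trunc_classZ i a : {morph trunc_class i : v / a *: v}.
Proof. exact: linear_propZ (@trunc_class_is_linear i) a. Qed.

Lemma trunc_classB i : {morph trunc_class i : u v / u - v}.
Proof. exact: linearB. Qed.

Lemma truncationE i a :
  qproj (ideal_pow I i.+1) a = a *: truncation_one I i.
Proof. by rewrite -[a in LHS]mulr1; apply: linearZ. Qed.

Lemma trunc_class_surj i (t : level I V i) : exists v, t = trunc_class i v.
Proof.
have cyclic (q : truncation I i) : exists a, q = a *: truncation_one I i.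
  by exists (repr q : A); rewrite -[LHS]qproj_repr truncationE.
by have [v ->] := tensor_cyclic t cyclic; exists v.
Qed.

(** The inverse of the isomorphism V/I^(i+1) V -> A/I^(i+1) (x) V; it detects
    the kernel of [trunc_class]. *)
Definition level_quot i (t : level I V i) : quotmod (ideal_pow_mod I V i.+1) :=
  tensor_lift (fun (q : truncation I i) v => qproj _ (repr q *: v)) t.

(** The choice of representative made in [level_quot] is immaterial. *)
Lemma qproj_reprZ i a v :
  qproj (ideal_pow_mod I V i.+1)
    (repr (qproj (ideal_pow I i.+1) a : truncation I i) *: v) =
  qproj (ideal_pow_mod I V i.+1) (a *: v).
Proof.
set r := repr _; apply/eqP; rewrite qproj_eq -scalerBl; apply: mem_span.
have rI : (r : A^o) - a \in ideal_pow I i.+1 by rewrite -qproj_eq qproj_repr.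
by exists (r - a) => //; exists v.
Qed.

Lemma level_quot_trunc_class i v : level_quot (trunc_class i v) = qproj _ v.
Proof.
rewrite /level_quot tensor_liftE => [|w a p q|q a w w'].
- by rewrite /truncation_one qproj_reprZ scale1r.
- rewrite -[p]qproj_repr -[q]qproj_repr -linearP !qproj_reprZ.
  by rewrite scalerDl -scalerA linearP.
- by rewrite scalerDr scalerA mulrC -scalerA linearP.
Qed.

Lemma trunc_class_eq0 i v :
  (trunc_class i v == 0) = (v \in ideal_pow_mod I V i.+1).
Proof.
apply/eqP/idP => [v0|].
  have := level_quot_trunc_class i v; rewrite v0.
  rewrite -(trunc_class0 i) level_quot_trunc_class => /eqP.
  by rewrite eq_sym qproj_eq subr0.
apply: (span_ker (f := trunc_class i)) => _ [a aI [w ->]].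
(* The scalar a moves to the left factor, where its class is 0. *)
rewrite -[LHS]/(trunc_class i (a *: w)) /trunc_class tensZr -tensZl -truncationE.
have /eqP -> : qproj (ideal_pow I i.+1) a == qproj _ 0 by rewrite qproj_eq subr0.
by rewrite truncationE scale0r; apply: linear_prop0 (tens_linearl w).
Qed.

Lemma trunc_class_eq i u v :
  (trunc_class i u == trunc_class i v) = (u - v \in ideal_pow_mod I V i.+1).
Proof. by rewrite -trunc_class_eq0 trunc_classB subr_eq0. Qed.

Lemma level_map_trunc_class i v :
  level_map (trunc_class i.+1 v) = trunc_class i v.
Proof. by rewrite level_mapE truncation_mapE. Qed.

(** The index is shifted, as level i is the quotient by I^(i+1).  Only sequences
    with this fixed rate occur, which is enough to describe the completion. *)
Definition adic_cauchy (s : nat -> V) : Prop :=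
  forall i, s i.+1 - s i \in ideal_pow_mod I V i.+1.

Definition adic_limit (s : nat -> V) (v : V) : Prop :=
  forall i, v - s i \in ideal_pow_mod I V i.+1.

Lemma completion_proj_inj (x y : completion I V) :
  (forall i, completion_proj i x = completion_proj i y) -> x = y.
Proof. by move=> xy; apply/val_inj/functional_extensionality_dep. Qed.

Lemma completion_of_cauchy s : adic_cauchy s ->
  exists x : completion I V, forall i, completion_proj i x = trunc_class i (s i).
Proof.
move=> sC.
suff xC : (fun i => trunc_class i (s i)) \in
    compatible (fun i => @level_map A I V i : {linear _ -> _}).
  by exists (Submod xC).
apply/asboolP => i /=; rewrite level_map_trunc_class.
by apply/eqP; rewrite trunc_class_eq.
Qed.

(** Lifting each projection of x to V gives the sequence; compatibility of the
    projections is exactly the Cauchy condition. *)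
Lemma completion_repr (x : completion I V) : exists2 s, adic_cauchy s &
  forall i, completion_proj i x = trunc_class i (s i).
Proof.
have /choice [s xs] i := trunc_class_surj (completion_proj i x).
exists s => // i; rewrite -trunc_class_eq -xs -level_map_trunc_class -xs.
by have /asboolP -> := valP x.
Qed.

Lemma adically_complete_cauchy s : adically_complete I V -> adic_cauchy s ->
  exists v, adic_limit s v.
Proof.
move=> [g _ gK] /completion_of_cauchy[x xs]; exists (g x) => i.
by rewrite -trunc_class_eq -xs -[in eqbRHS](gK x).
Qed.

Lemma cauchy_adically_complete :
  (forall v, (forall i, v \in ideal_pow_mod I V i) -> v = 0) ->
  (forall s, adic_cauchy s -> exists v, adic_limit s v) ->
  adically_complete I V.
Proof.
move=> sep lim.
have tau_surj (x : completion I V) : exists v, completion_map I v = x.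
  have [s /lim[v sv] xs] := completion_repr x; exists v.
  by apply: completion_proj_inj => i; apply/eqP; rewrite xs trunc_class_eq.
have /choice [g gK] := tau_surj; exists g => // v.
apply/eqP; rewrite -subr_eq0; apply/eqP/sep => -[|i].
  exact: mem_ideal_pow_mod0.
rewrite -trunc_class_eq; apply/eqP.
by rewrite -[LHS]/(completion_proj i (completion_map I (g _))) gK.
Qed.

End AdicModule.

Lemma ideal_pow_mod_linear (A : comPzRingType) (I : ideal A) (U V : lmodType A)
    (f : {linear U -> V}) n u :
  u \in ideal_pow_mod I U n -> f u \in ideal_pow_mod I V n.
Proof.
set W := ideal_pow_mod I V n.
move/spanP/(_ (fun u => f u \in W)); apply.
  split=> [|a v w fv fw]; rewrite -topredE /= ?linear0 ?rpred0//.
  by rewrite linearP rpredD ?rpredZ.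
move=> _ [a aI [v ->]]; rewrite -topredE /= linearZ; apply: mem_span.
by exists a => //; exists (f v).
Qed.

(** * The two filtrations of a completion *)

Section Completion.
Variables (A : comPzRingType) (I : ideal A) (M : lmodType A).
Local Notation N := (completion I M).
Implicit Types x y : N.

Lemma completion_proj0 i : completion_proj i (0 : N) = 0.
Proof. by []. Qed.

Lemma completion_projB i :
  {morph @completion_proj A I M i : x y / x - y}.
Proof. by []. Qed.

Lemma completion_projZ i a : {morph @completion_proj A I M i : x / a *: x}.
Proof. by []. Qed.

Lemma completion_projS i x :
  level_map (completion_proj i.+1 x) = completion_proj i x.
Proof. by have /asboolP := valP x; apply. Qed.

Lemma level_map0 i : level_map (0 : level I M i.+1) = 0.
Proof. exact: linear_prop0 (@level_map_is_linear A I M i). Qed.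

Lemma mem_kerfiltS i x : (x \in @kerfilt A I M i.+1) = (completion_proj i x == 0).
Proof. by []. Qed.

Lemma mem_kerfiltB i x y :
  (x - y \in @kerfilt A I M i.+1) = (completion_proj i x == completion_proj i y).
Proof. by rewrite mem_kerfiltS completion_projB subr_eq0. Qed.

(** The kernels decrease because each projection factors through the next. *)
Lemma kerfiltS i x : x \in @kerfilt A I M i.+1 -> x \in @kerfilt A I M i.
Proof.
case: i => // i; rewrite !mem_kerfiltS -(completion_projS i) => /eqP->.
by rewrite level_map0.
Qed.

(** The ideal I^(i+1) kills level i, hence the projection kills
    I^(i+1) N. *)
Lemma ideal_pow_mod_kerfilt i x :
  x \in ideal_pow_mod I N i -> x \in @kerfilt A I M i.
Proof.
case: i => // i xI; rewrite mem_kerfiltS; apply/eqP.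
have genK (z : N) :
    (exists2 a : A, a \in ideal_pow I i.+1 & exists y : N, z = a *: y) ->
    completion_proj i z = 0.
  move=> [a aI [y ->]]; rewrite completion_projZ.
  have [v ->] := trunc_class_surj (completion_proj i y).
  rewrite -trunc_classZ; apply/eqP; rewrite trunc_class_eq0.
  by apply: mem_span; exists a => //; exists v.
exact: (@span_ker A N (level I M i) (@completion_proj A I M i) _ x genK xI).
Qed.

(** A Cauchy sequence s of M representing x becomes I-adically convergent in N
    by completeness.  Its I-adic limit is x, and its distance to the term of
    index i, itself in I^(i+1) N, puts x in I^(i+1) N. *)
Lemma complete_kerfilt i x : adically_complete I N ->
  x \in @kerfilt A I M i -> x \in ideal_pow_mod I N i.
Proof.
move=> Ncomp; case: i => [|i] xF; first exact: mem_ideal_pow_mod0.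
have [s sC xs] := completion_repr x.
pose t k := completion_map I (s k).
have [k|y ty] := adically_complete_cauchy (s := t) Ncomp.
  by rewrite /t -linearB; apply: ideal_pow_mod_linear.
suff -> : x = y.
  rewrite -(subrK (t i) y) rpredD// /t; apply: ideal_pow_mod_linear.
  by rewrite mem_kerfiltS xs trunc_class_eq0 in xF.
apply: completion_proj_inj => k; apply/eqP; rewrite xs eq_sym.
by have := ideal_pow_mod_kerfilt (ty k); rewrite mem_kerfiltB.
Qed.

(** N is always separated and complete for the filtration by kernels, so it is
    I-adically complete once the two filtrations agree. *)
Lemma kerfilt_complete :
  (forall i, ideal_pow_mod I N i =i @kerfilt A I M i) -> adically_complete I N.
Proof.
move=> IF; apply: cauchy_adically_complete => [x xI|s sC].
  apply: completion_proj_inj => i; apply/eqP.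
  by rewrite completion_proj0 -mem_kerfiltS -IF.
(* Hence the i-th projections of the s i form a compatible family. *)
have pS i : completion_proj i (s i.+1) = completion_proj i (s i).
  by apply/eqP; rewrite -mem_kerfiltB -IF; apply: sC.
suff yC : (fun i => completion_proj i (s i)) \in
    compatible (fun i => @level_map A I M i : {linear _ -> _}).
  by exists (Submod yC) => i; rewrite IF mem_kerfiltB.
by apply/asboolP => i /=; rewrite completion_projS pS.
Qed.

End Completion.

Theorem corollary1p12 (R : realType) (A : comPzRingType) (I : ideal A)
    (M : lmodType A) :
  adically_complete I (completion I M) <->
  (forall m n : completion I M, adic_dist R I m n = ker_dist R m n).
Proof.
rewrite (filt_dist_eqP R (@mem_ideal_pow_mod0 A I _) (@ideal_pow_modS A I _) _
  (@kerfiltS A I M))//.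
split=> [Ncomp i x|]; last exact: kerfilt_complete.
by apply/idP/idP => [/ideal_pow_mod_kerfilt|/(complete_kerfilt Ncomp)].
Qed.
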